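(* Let $\mathcal{F}$ be a complex vector space of entire functions $\mathbb{C}\to\mathbb{C}$ which contains the function $z \mapsto e^{\xi z}$ for every $\xi \in \mathbb{C}\setminus\{0\}$. Let $\theta \in \mathbb{R}$ and let $\Lambda \subseteq \mathbb{R}$. Then the set $e^{i\theta}(\mathbb{R}+i\Lambda) = \{ e^{i\theta}(x+i\lambda) : x \in \mathbb{R},\ \lambda \in \Lambda\}$ is a uniqueness set for the phase retrieval problem in $\mathcal{F}$ if and only if $\Lambda$ is not contained in an arithmetic progression.
   Context: An arithmetic progression is a set of the form $a\mathbb{Z}+b = \{an+b : n\in\mathbb{Z}\}$ with $a,b\in\mathbb{R}$ (the choice $a=0$ is allowed). For complex-valued functions $F,H$ write $F\sim H$ if there is $\tau\in\mathbb{C}$ with $|\tau|=1$ and $F=\tau H$. A set $\mathcal{U}\subseteq\mathbb{C}$ is a uniqueness set for the phase retrieval problem in a set $\mathcal{F}$ of entire functions if for all $F,H\in\mathcal{F}$: $|F(z)|=|H(z)|$ for all $z\in\mathcal{U}$ implies $F\sim H$. *)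

(* Defs.v *)
From Stdlib Require Import Reals ZArith.
From Coquelicot Require Import Coquelicot.

Open Scope R_scope.

(* Coquelicot has no complex exponential; this is e^x (cos y + i sin y) at
   x + i y. *)
Definition Cexp (z : C) : C :=
  (exp (Re z) * cos (Im z), exp (Re z) * sin (Im z)).

(* Over [C_AbsRing], [ex_derive] is complex differentiability. *)
Definition entire (f : C -> C) : Prop :=
  forall z : C, ex_derive (K := C_AbsRing) (V := C_NormedModule) f z.

Record entire_function_space (F : (C -> C) -> Prop) : Prop := {
  efs_entire : forall f, F f -> entire f;
  efs_zero : F (fun _ => RtoC 0);
  efs_plus : forall f g, F f -> F g -> F (fun z => (f z + g z)%C);
  efs_scal : forall (c : C) f, F f -> F (fun z => (c * f z)%C)
}.

Definition phase_equiv (f h : C -> C) : Prop :=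
  exists tau : C, Cmod tau = 1 /\ forall z : C, f z = (tau * h z)%C.

Definition phase_uniqueness_set (U : C -> Prop) (F : (C -> C) -> Prop) : Prop :=
  forall f h : C -> C, F f -> F h ->
    (forall z : C, U z -> Cmod (f z) = Cmod (h z)) -> phase_equiv f h.

Definition arithmetic_progression (a b : R) (x : R) : Prop :=
  exists n : Z, x = a * IZR n + b.

Definition rotated_lines (theta : R) (Lambda : R -> Prop) (z : C) : Prop :=
  exists x lambda : R, Lambda lambda /\
    z = (Cexp (Ci * RtoC theta) * (RtoC x + Ci * RtoC lambda))%C.

(* Main.v *)
Require Import Defs.
From Stdlib Require Import Reals ZArith Lra Lia Psatz Classical.
From Coquelicot Require Import Coquelicot.

(** On a horizontal line [Im z = mu], with [f*(z)] the conjugate of [f] at the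
    conjugate of [z], the equality [|f| = |h|] says that [f(z + 2 i mu) f*(z)]
    and [h(z + 2 i mu) h*(z)] agree on a line, hence everywhere. Two such lines
    at distance [mu] make [2 i mu] a period of [f / h]. The real numbers [t] for
    which [i t] is a period form a subgroup; if the lines do not lie on an
    arithmetic progression it is not cyclic, hence dense, and [f / h] is
    constant. Otherwise the lines lie on [a Z + b], and [E + i E^2], [E - i E^2]
    with [E] an exponential of period [2 i a] are a counterexample.

    The identity theorem is obtained from Goursat's theorem alone: it gives the
    maximum principle on circles; applied to [g / (z - p)^n], which stays entire
    when [g] vanishes near [p], this forces [g = 0]. An entire function
    vanishing on a line may be replaced by [0] on one side of it and remains
    entire, so it vanishes too. *)

(** * Goursat's theorem on rectangles, by bisection *)

(** The left ends increase and stay below every right end, so their supremum lies in all the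
    intervals. *)
Lemma nested_intervals (a w : nat -> R) :
  (forall n, 0 <= w n) -> (forall n, a n <= a (S n)) ->
  (forall n, a (S n) + w (S n) <= a n + w n) ->
  exists x, forall n, a n <= x <= a n + w n.
Proof.
  intros Hw Ha Hb.
  assert (Hup : forall n k, a n <= a (n + k)%nat).
  { intros n k; induction k as [|k IH]; [rewrite Nat.add_0_r; lra|].
    rewrite Nat.add_succ_r; specialize (Ha (n + k)%nat); lra. }
  assert (Hdown : forall n k, a (n + k)%nat + w (n + k)%nat <= a n + w n).
  { intros n k; induction k as [|k IH]; [rewrite Nat.add_0_r; lra|].
    rewrite Nat.add_succ_r; specialize (Hb (n + k)%nat); lra. }
  assert (Hmn : forall m n, a m <= a n + w n).
  { intros m n; destruct (Nat.le_ge_cases m n) as [H|H].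
    - replace n with (m + (n - m))%nat by lia.
      specialize (Hup m (n - m)%nat); specialize (Hw (m + (n - m))%nat); lra.
    - specialize (Hdown n (m - n)%nat); specialize (Hw m).
      replace (n + (m - n))%nat with m in Hdown by lia; lra. }
  destruct (completeness (fun x => exists n, x = a n)) as [x [Hub Hlub]].
  - exists (a 0%nat + w 0%nat); intros y [n ->]; apply Hmn.
  - exists (a 0%nat); exists 0%nat; reflexivity.
  - exists x; intros n; split.
    + apply Hub; exists n; reflexivity.
    + apply Hlub; intros y [m ->]; apply Hmn.
Qed.

(* The outward flux of the vector field (u, -v) through the boundary of
   [a, b] x [c, d]. *)
Definition flux (u v : R -> R -> R) (a b c d : R) : R :=
  RInt (fun y => u b y - u a y) c d - RInt (fun x => v x d - v x c) a b.

Lemma ex_RInt_continuous_fun (g : R -> R) (a b : R) :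
  (forall x, continuous g x) -> ex_RInt g a b.
Proof. intros Hg; apply (ex_RInt_continuous (V := R_CompleteNormedModule)); auto. Qed.

Lemma RInt_sub_continuous (g k : R -> R) (a b : R) :
  (forall x, continuous g x) -> (forall x, continuous k x) ->
  RInt (fun x => g x - k x) a b = RInt g a b - RInt k a b.
Proof.
  intros Hg Hk.
  apply (RInt_minus (V := R_CompleteNormedModule)); now apply ex_RInt_continuous_fun.
Qed.

Lemma RInt_dist_const_le (g : R -> R) (a b k e : R) :
  a <= b -> (forall x, continuous g x) ->
  (forall x, a <= x <= b -> Rabs (g x - k) <= e) ->
  Rabs (RInt g a b - k * (b - a)) <= e * (b - a).
Proof.
  intros Hab Hg He.
  assert (Hk : RInt (fun x => g x - k) a b = RInt g a b - k * (b - a)).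
  { rewrite RInt_sub_continuous, RInt_const by (auto using continuous_const).
    unfold scal; simpl; unfold mult; simpl; ring. }
  rewrite <- Hk, Rmult_comm.
  apply abs_RInt_le_const; [exact Hab| |exact He].
  apply ex_RInt_continuous_fun; intros x.
  apply (continuous_minus (V := R_NormedModule)); [apply Hg | apply continuous_const].
Qed.

Section Goursat.

Context (u v : R -> R -> R)
  (Hu : forall x y, continuous (fun t => u x t) y)
  (Hv : forall x y, continuous (fun t => v t y) x).

(** The side at [m] enters the two halves with opposite signs. *)
Lemma flux_bisect_x (a m b c d : R) :
  flux u v a b c d = flux u v a m c d + flux u v m b c d.
Proof.
  unfold flux.
  rewrite <- (RInt_Chasles (fun x => v x d - v x c) a m b)
    by (apply ex_RInt_continuous_fun; intros x; apply (continuous_minus (V := R_NormedModule)); auto).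
  rewrite !RInt_sub_continuous by auto; unfold plus; simpl.
  ring.
Qed.

Lemma flux_bisect_y (a b c n d : R) :
  flux u v a b c d = flux u v a b c n + flux u v a b n d.
Proof.
  unfold flux.
  rewrite <- (RInt_Chasles (fun y => u b y - u a y) c n d)
    by (apply ex_RInt_continuous_fun; intros x; apply (continuous_minus (V := R_NormedModule)); auto).
  rewrite !RInt_sub_continuous by auto; unfold plus; simpl.
  ring.
Qed.

(** The fluxes of the four quarters add up to the whole, and [e * (w + h) ^ 2] is four times the
    bound for a quarter, so some quarter violates its bound. A sigma type, because a sequence is
    built from it by recursion. *)
Lemma flux_quarter (e w h a c : R) :
  0 <= w -> 0 <= h ->
  e * (w + h) ^ 2 < Rabs (flux u v a (a + w) c (c + h)) ->
  {p : R * R | a <= fst p /\ fst p + w / 2 <= a + w /\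
               c <= snd p /\ snd p + h / 2 <= c + h /\
     e * (w / 2 + h / 2) ^ 2 <
       Rabs (flux u v (fst p) (fst p + w / 2) (snd p) (snd p + h / 2))}.
Proof.
  intros Hw Hh Hbad.
  pose (bad := fun a' c' => e * (w / 2 + h / 2) ^ 2 <
       Rabs (flux u v a' (a' + w / 2) c' (c' + h / 2))).
  assert (Hdec : forall a' c', {bad a' c'} + {~ bad a' c'}) by (intros; apply Rlt_dec).
  destruct (Hdec a c) as [H1|H1];
    [exists (a, c); simpl; repeat split; try exact H1; lra|].
  destruct (Hdec a (c + h / 2)) as [H2|H2];
    [exists (a, c + h / 2); simpl; repeat split; try exact H2; lra|].
  destruct (Hdec (a + w / 2) c) as [H3|H3];
    [exists (a + w / 2, c); simpl; repeat split; try exact H3; lra|].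
  exists (a + w / 2, c + h / 2); cbn [fst snd]; repeat split; try lra.
  apply Rnot_le_lt; intros H4.
  unfold bad in *.
  rewrite (flux_bisect_x a (a + w / 2)), (flux_bisect_y _ _ c (c + h / 2)),
    (flux_bisect_y _ (a + w) c (c + h / 2)) in Hbad.
  replace (a + w / 2 + w / 2) with (a + w) in * by lra.
  replace (c + h / 2 + h / 2) with (c + h) in * by lra.
  replace (e * (w + h) ^ 2) with (4 * (e * (w / 2 + h / 2) ^ 2)) in Hbad by field.
  apply Rnot_lt_le in H1, H2, H3.
  set (q := e * (w / 2 + h / 2) ^ 2) in *.
  apply Rabs_le_between in H1, H2, H3, H4.
  apply (Rlt_not_le _ _ Hbad), Rabs_le.
  lra.
Qed.

(** The shared coefficient [p] is the Cauchy-Riemann equation [u_x = v_y], which makes the field (u,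
    -v) free of divergence. *)
Hypothesis Hd : forall x0 y0, exists p q r, forall e, 0 < e ->
  exists delta, 0 < delta /\ forall x y,
    Rabs (x - x0) < delta -> Rabs (y - y0) < delta ->
    Rabs (u x y - u x0 y0 - p * (x - x0) - q * (y - y0)) <= e * (Rabs (x - x0) + Rabs (y - y0)) /\
    Rabs (v x y - v x0 y0 - r * (x - x0) - p * (y - y0)) <= e * (Rabs (x - x0) + Rabs (y - y0)).

(** The linear parts contribute [p * w * h] to both integrals and cancel; only the remainders are
    left, each at most [e / 2 * (w + h)]. *)
Lemma flux_small_near (x0 y0 e : R) : 0 < e ->
  exists delta, 0 < delta /\ forall a w c h, 0 <= w < delta -> 0 <= h < delta ->
    a <= x0 <= a + w -> c <= y0 <= c + h ->
    Rabs (flux u v a (a + w) c (c + h)) <= e * (w + h) ^ 2.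
Proof.
  intros He; destruct (Hd x0 y0) as (p & q & r & Hpqr).
  destruct (Hpqr (e / 2)) as (delta & Hdelta & Hloc); [lra|].
  exists delta; split; [exact Hdelta|].
  intros a w c h Hw Hh Hx Hy.
  assert (Hin : forall x, a <= x <= a + w -> Rabs (x - x0) <= w)
    by (intros x Hx1; apply Rabs_le; lra).
  assert (Hin' : forall y, c <= y <= c + h -> Rabs (y - y0) <= h)
    by (intros x Hx1; apply Rabs_le; lra).
  assert (Hrem : forall x y, a <= x <= a + w -> c <= y <= c + h ->
    Rabs (u x y - u x0 y0 - p * (x - x0) - q * (y - y0)) <= e / 2 * (w + h) /\
    Rabs (v x y - v x0 y0 - r * (x - x0) - p * (y - y0)) <= e / 2 * (w + h)).
  { intros x y Hx1 Hy1; specialize (Hin x Hx1); specialize (Hin' y Hy1).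
    destruct (Hloc x y) as [H1 H2]; try lra.
    assert (e / 2 * (Rabs (x - x0) + Rabs (y - y0)) <= e / 2 * (w + h))
      by (apply Rmult_le_compat_l; lra).
    split; lra. }
  assert (I1 : Rabs (RInt (fun y => u (a + w) y - u a y) c (c + h) - p * w * (c + h - c))
                 <= e * (w + h) * (c + h - c)).
  { apply RInt_dist_const_le; [lra| |].
    - intros y; apply (continuous_minus (V := R_NormedModule)); auto.
    - intros y Hy1; destruct (Hrem (a + w) y) as [H1 _]; try lra.
      destruct (Hrem a y) as [H2 _]; try lra.
      apply Rabs_le; apply Rabs_le_between in H1, H2; lra. }
  assert (I2 : Rabs (RInt (fun x => v x (c + h) - v x c) a (a + w) - p * h * (a + w - a))
                 <= e * (w + h) * (a + w - a)).
  { apply RInt_dist_const_le; [lra| |].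
    - intros y; apply (continuous_minus (V := R_NormedModule)); auto.
    - intros y Hy1; destruct (Hrem y (c + h)) as [_ H1]; try lra.
      destruct (Hrem y c) as [_ H2]; try lra.
      apply Rabs_le; apply Rabs_le_between in H1, H2; lra. }
  unfold flux.
  apply Rabs_le; apply Rabs_le_between in I1, I2; lra.
Qed.

(** A nonzero flux would yield nested bad rectangles, each a quarter of the previous one, shrinking
    to a point where [flux_small_near] contradicts badness. *)
Lemma flux_zero_size (a w c h : R) : 0 <= w -> 0 <= h ->
  flux u v a (a + w) c (c + h) = 0.
Proof.
  intros Hw Hh.
  destruct (Req_dec (flux u v a (a + w) c (c + h)) 0) as [H0|H0]; [exact H0|exfalso].
  pose (F := Rabs (flux u v a (a + w) c (c + h))).
  assert (HF : 0 < F) by (now apply Rabs_pos_lt).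
  (* The summand 1 keeps the denominator positive and [Hbad] strict even when [w + h = 0]. *)
  pose (e := F / (2 * (1 + (w + h) ^ 2))).
  assert (Hp2 : 0 <= (w + h) ^ 2) by apply pow2_ge_0.
  assert (He : 0 < e) by (apply Rdiv_lt_0_compat; lra).
  assert (Hbad : e * (w + h) ^ 2 < F).
  { replace F with (e * (2 * (1 + (w + h) ^ 2))) by (unfold e; field; lra).
    apply Rmult_lt_compat_l; lra. }
  pose (bad := fun n (p : R * R) => e * (w / 2 ^ n + h / 2 ^ n) ^ 2 <
     Rabs (flux u v (fst p) (fst p + w / 2 ^ n) (snd p) (snd p + h / 2 ^ n))).
  assert (Hsz : forall k n, 0 <= k -> 0 <= k / 2 ^ n).
  { intros k n Hk; apply Rmult_le_pos; [lra|].
    apply Rlt_le, Rinv_0_lt_compat, pow_lt; lra. }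
  assert (Hhalf : forall k n, k / 2 ^ n / 2 = k / 2 ^ S n).
  { intros k n; simpl; field; apply pow_nonzero; lra. }
  assert (step : forall n (p : R * R), bad n p -> {p' : R * R |
     fst p <= fst p' /\ fst p' + w / 2 ^ S n <= fst p + w / 2 ^ n /\
     snd p <= snd p' /\ snd p' + h / 2 ^ S n <= snd p + h / 2 ^ n /\ bad (S n) p'}).
  { intros n p Hp; unfold bad; rewrite <- !Hhalf.
    apply flux_quarter; auto. }
  assert (H00 : bad 0%nat (a, c)).
  { unfold bad; rewrite pow_O, !Rdiv_1_r; exact Hbad. }
  (* Each term carries the proof of its own badness, which the next step consumes. *)
  pose (s := fix s n : {p | bad n p} := match n with
     | O => exist _ (a, c) H00
     | S m => let (p', H) := step m (proj1_sig (s m)) (proj2_sig (s m)) in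
              exist _ p' (proj2 (proj2 (proj2 (proj2 H)))) end).
  assert (Hs : forall n, let p := proj1_sig (s n) in let p' := proj1_sig (s (S n)) in
     fst p <= fst p' /\ fst p' + w / 2 ^ S n <= fst p + w / 2 ^ n /\
     snd p <= snd p' /\ snd p' + h / 2 ^ S n <= snd p + h / 2 ^ n).
  { intros n p p'.
    change p' with (proj1_sig (let (p', H) := step n p (proj2_sig (s n)) in
      exist (bad (S n)) p' (proj2 (proj2 (proj2 (proj2 H)))))).
    destruct (step n p (proj2_sig (s n))) as [p'' (H1 & H2 & H3 & H4 & H5)].
    cbn [proj1_sig]; auto. }
  destruct (nested_intervals (fun n => fst (proj1_sig (s n))) (fun n => w / 2 ^ n))
    as [x0 Hx0]; try (intros n; apply (Hs n)); auto.
  destruct (nested_intervals (fun n => snd (proj1_sig (s n))) (fun n => h / 2 ^ n))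
    as [y0 Hy0]; try (intros n; apply (Hs n)); auto.
  destruct (flux_small_near x0 y0 e He) as (delta & Hdelta & Hsmall).
  (* This makes both sides of the [N]-th rectangle shorter than [delta]. *)
  destruct (pow_lt_1_zero (/ 2)) with (y := delta / (1 + w + h)) as [N HN].
  - rewrite Rabs_pos_eq; lra.
  - apply Rdiv_lt_0_compat; lra.
  - specialize (HN N (Nat.le_refl N)).
    rewrite pow_inv in HN.
    assert (Hpos : 0 < / 2 ^ N) by (apply Rinv_0_lt_compat, pow_lt; lra).
    rewrite Rabs_pos_eq in HN by lra.
    assert (HN' : / 2 ^ N * (1 + w + h) < delta).
    { apply Rmult_lt_compat_r with (r := 1 + w + h) in HN; [|lra].
      replace (delta / (1 + w + h) * (1 + w + h)) with delta in HN by (field; lra).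
      exact HN. }
    apply (Rlt_irrefl (e * (w / 2 ^ N + h / 2 ^ N) ^ 2)).
    apply Rlt_le_trans with (1 := proj2_sig (s N)).
    apply Hsmall; auto; split; auto; unfold Rdiv; nra.
Qed.

Lemma flux_eq_0 (a b c d : R) : a <= b -> c <= d -> flux u v a b c d = 0.
Proof.
  intros Hab Hcd.
  replace b with (a + (b - a)) by ring; replace d with (c + (d - c)) by ring.
  apply flux_zero_size; lra.
Qed.

End Goursat.

(** * Complex derivatives *)

Notation is_cderive f z l := (is_derive (K := C_AbsRing) (V := C_NormedModule) f z l).
Notation ex_cderive f z := (ex_derive (K := C_AbsRing) (V := C_NormedModule) f z).

Lemma is_cderive_iff (f : C -> C) (z l : C) :
  is_cderive f z l <->
  forall e : R, 0 < e -> exists d : R, 0 < d /\ forall w : C, Cmod (w - z) < d ->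
    Cmod (f w - f z - (w - z) * l) <= e * Cmod (w - z).
Proof.
  split.
  - intros [_ Hf] e He.
    destruct (Hf z (fun P H => H) (mkposreal e He)) as [d Hd].
    exists d; split; [apply cond_pos|]; intros w Hw; exact (Hd w Hw).
  - intros Hf; split; [apply is_linear_scal_l|].
    intros x Hx e.
    apply (is_filter_lim_locally_unique (V := AbsRing_NormedModule C_AbsRing)) in Hx; subst x.
    destruct (Hf e (cond_pos e)) as (d & Hd & Hloc).
    exists (mkposreal d Hd); intros w Hw; exact (Hloc w Hw).
Qed.

(* Coquelicot's [C_NormedModule] and [AbsRing_NormedModule C_AbsRing] carry
   different uniform structures, but the same norm. *)
Lemma is_cderive_ring (f : C -> C) (z l : C) :
  is_cderive f z l <->
  is_derive (K := C_AbsRing) (V := AbsRing_NormedModule C_AbsRing) f z l.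
Proof. split; intros [_ H]; (split; [apply is_linear_scal_l | exact H]). Qed.

Lemma ex_cderive_comp (f g : C -> C) (z : C) :
  ex_cderive f (g z) -> ex_cderive g z -> ex_cderive (fun w => f (g w)) z.
Proof.
  intros [l Hl] [m Hm]; exists (scal m l).
  apply (is_derive_comp (K := C_AbsRing) (V := C_NormedModule)); [|apply is_cderive_ring]; assumption.
Qed.

Lemma ex_cderive_plus (f g : C -> C) (z : C) :
  ex_cderive f z -> ex_cderive g z -> ex_cderive (fun w => (f w + g w)%C) z.
Proof. apply (ex_derive_plus (K := C_AbsRing) (V := C_NormedModule)). Qed.

Lemma ex_cderive_minus (f g : C -> C) (z : C) :
  ex_cderive f z -> ex_cderive g z -> ex_cderive (fun w => (f w - g w)%C) z.
Proof. apply (ex_derive_minus (K := C_AbsRing) (V := C_NormedModule)). Qed.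

Lemma ex_cderive_const (c z : C) : ex_cderive (fun _ => c) z.
Proof. apply (ex_derive_const (K := C_AbsRing) (V := C_NormedModule)). Qed.

Lemma ex_cderive_id (z : C) : ex_cderive (fun w => w) z.
Proof. exists (RtoC 1). apply is_cderive_iff. intros e He; exists 1; split; [lra|].
  intros w Hw; replace (w - z - (w - z) * 1)%C with (RtoC 0) by ring.
  rewrite Cmod_0; apply Rmult_le_pos; [lra | apply Cmod_ge_0].
Qed.

(** The product is the pair of functions followed by the multiplication map of the ring, whose
    derivative lives over [AbsRing_NormedModule C_AbsRing]; hence the passage through
    [is_cderive_ring]. *)
Lemma ex_cderive_mult (f g : C -> C) (z : C) :
  ex_cderive f z -> ex_cderive g z -> ex_cderive (fun w => (f w * g w)%C) z.
Proof.
  intros [l Hl] [m Hm]; exists (l * g z + f z * m)%C.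
  apply (proj1 (is_cderive_ring _ _ _)) in Hl, Hm; apply (proj2 (is_cderive_ring _ _ _)).
  eapply filterdiff_ext_lin.
  - apply (filterdiff_comp'_2 (T := AbsRing_NormedModule C_AbsRing)
      (U := AbsRing_NormedModule C_AbsRing) (V := AbsRing_NormedModule C_AbsRing)
      (W := AbsRing_NormedModule C_AbsRing) f g (fun a b : C_AbsRing => mult a b) z
      _ _ (fun a b => plus (mult a (g z)) (mult (f z) b)) Hl Hm).
    apply (filterdiff_mult (K := C_AbsRing) (f z, g z)).
    + intros P HP; exact HP.
    + intros a b; apply Cmult_comm.
  - intros y; unfold plus, scal, mult; simpl; unfold mult; simpl; ring.
Qed.

Lemma ex_cderive_continuous (f : C -> C) (z : C) : ex_cderive f z ->
  forall e, 0 < e -> exists d, 0 < d /\ forall w, Cmod (w - z) < d -> Cmod (f w - f z) < e.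
Proof.
  intros [l Hl] e He; rewrite is_cderive_iff in Hl.
  destruct (Hl 1 Rlt_0_1) as (d & Hd & Hloc).
  assert (Hl0 := Cmod_ge_0 l).
  exists (Rmin d (e / (2 + Cmod l))); split.
  - apply Rmin_pos; [exact Hd | apply Rdiv_lt_0_compat; lra].
  - intros w Hw.
    assert (Hw1 := Rlt_le_trans _ _ _ Hw (Rmin_l _ _)).
    assert (Hw2 := Rlt_le_trans _ _ _ Hw (Rmin_r _ _)).
    specialize (Hloc w Hw1).
    replace (f w - f z)%C with ((f w - f z - (w - z) * l) + (w - z) * l)%C by ring.
    apply Rle_lt_trans with (1 := Cmod_triangle _ _).
    rewrite Cmod_mult.
    apply (Rmult_lt_compat_r (2 + Cmod l)) in Hw2; [|lra].
    replace (e / (2 + Cmod l) * (2 + Cmod l)) with e in Hw2 by (field; lra).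
    assert (Hw0 := Cmod_ge_0 (w - z)); nra.
Qed.

Lemma ex_cderive_inv (z : C) : z <> RtoC 0 -> ex_cderive (fun w => / w)%C z.
Proof.
  intros Hz; exists (- / (z * z))%C; apply is_cderive_iff; intros e He.
  assert (Hz0 : 0 < Cmod z) by (now apply Cmod_gt_0).
  set (r := Cmod z) in *.
  (* The first radius keeps [Cmod w] above [r / 2]; the remainder [(w - z)^2 / (w z^2)] is then at
     most [2 * Cmod (w - z) ^ 2 / r ^ 3]. *)
  exists (Rmin (r / 2) (e * r ^ 3 / 2)); split.
  - apply Rmin_pos; [lra|]. apply Rdiv_lt_0_compat; [|lra].
    apply Rmult_lt_0_compat; [lra | now apply pow_lt].
  - intros w Hw.
    assert (Hw1 := Rlt_le_trans _ _ _ Hw (Rmin_l _ _)).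
    assert (Hw2 := Rlt_le_trans _ _ _ Hw (Rmin_r _ _)).
    assert (Hwr : r / 2 < Cmod w).
    { assert (H := Cmod_triangle (z - w) w).
      replace (z - w + w)%C with z in H by ring.
      replace (z - w)%C with (- (w - z))%C in H by ring.
      rewrite Cmod_opp in H; fold r in H; lra. }
    assert (Hw0 : w <> RtoC 0) by (apply (proj2 (Cmod_gt_0 w)); lra).
    replace (/ w - / z - (w - z) * - / (z * z))%C with ((w - z) * ((w - z) / (w * z * z)))%C
      by (now field).
    rewrite Cmod_mult, Rmult_comm; apply Rmult_le_compat_r; [apply Cmod_ge_0|].
    rewrite Cmod_div by (repeat apply Cmult_neq_0; assumption).
    rewrite !Cmod_mult; fold r.
    assert (HD : r / 2 * r * r <= Cmod w * r * r).
    { repeat apply Rmult_le_compat_r; lra. }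
    assert (HD0 : 0 < r / 2 * r * r) by (repeat apply Rmult_lt_0_compat; lra).
    apply Rle_div_l; [lra|].
    apply Rle_trans with (e * (r / 2 * r * r)); [lra|].
    apply Rmult_le_compat_l; lra.
Qed.

Lemma entire_comp_affine (f : C -> C) (a b : C) :
  entire f -> entire (fun z => f (a * z + b)%C).
Proof.
  intros Hf z; apply (ex_cderive_comp f (fun w => a * w + b)%C); [apply Hf|].
  apply ex_cderive_plus; [|apply ex_cderive_const].
  apply ex_cderive_mult; [apply ex_cderive_const | apply ex_cderive_id].
Qed.

Lemma entire_mult (f g : C -> C) : entire f -> entire g -> entire (fun z => f z * g z)%C.
Proof. intros Hf Hg z; now apply ex_cderive_mult. Qed.

Lemma entire_minus (f g : C -> C) : entire f -> entire g -> entire (fun z => f z - g z)%C.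
Proof. intros Hf Hg z; now apply ex_cderive_minus. Qed.

(** Conjugation preserves moduli, so the estimate for [f] at [Cconj z] carries over to [z], with the
    conjugate derivative. *)
Lemma entire_conj (f : C -> C) : entire f -> entire (fun z => Cconj (f (Cconj z))).
Proof.
  intros Hf z; destruct (Hf (Cconj z)) as [l Hl]; exists (Cconj l).
  rewrite is_cderive_iff in *; intros e He.
  destruct (Hl e He) as (d & Hd & Hloc); exists d; split; [exact Hd|].
  intros w Hw.
  rewrite <- (Cmod_conj (w - z)), Cminus_conj in Hw |- *.
  rewrite <- Cmod_conj, !Cminus_conj, Cmult_conj, !Cconj_conj, Cminus_conj.
  now apply Hloc.
Qed.

(** * The complex exponential *)

Lemma Cexp_plus (z w : C) : Cexp (z + w) = (Cexp z * Cexp w)%C.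
Proof.
  unfold Cexp, Re, Im; apply injective_projections; simpl;
  rewrite exp_plus, ?cos_plus, ?sin_plus; ring.
Qed.

Lemma Cmod_Cexp (z : C) : Cmod (Cexp z) = exp (Re z).
Proof.
  unfold Cexp, Cmod; simpl.
  replace (_ + _) with ((exp (Re z))² * ((sin (Im z))² + (cos (Im z))²)) by (unfold Rsqr; ring).
  rewrite sin2_cos2, Rmult_1_r; apply sqrt_Rsqr, Rlt_le, exp_pos.
Qed.

Lemma Cexp_neq_0 (z : C) : Cexp z <> RtoC 0.
Proof. apply (proj2 (Cmod_gt_0 _)); rewrite Cmod_Cexp; apply exp_pos. Qed.

Lemma Cmod_le_Re_Im (z : C) : Cmod z <= Rabs (Re z) + Rabs (Im z).
Proof.
  assert (H1 := Rabs_pos (Re z)); assert (H2 := Rabs_pos (Im z)).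
  rewrite <- (Rabs_pos_eq (Cmod z)) by apply Cmod_ge_0.
  rewrite <- (Rabs_pos_eq (Rabs (Re z) + Rabs (Im z))) by lra.
  apply Rsqr_le_abs_0; rewrite !Rsqr_pow2, Cmod2_alt.
  rewrite <- (pow2_abs (Re z)), <- (pow2_abs (Im z)); nra.
Qed.

Lemma Rabs_Im_le_Cmod (z : C) : Rabs (Im z) <= Cmod z.
Proof.
  apply Rsqr_incr_0; [|apply Rabs_pos | apply Cmod_ge_0].
  rewrite !Rsqr_pow2, Cmod2_alt, pow2_abs; nra.
Qed.

Lemma derivable_pt_lim_0_bound (f : R -> R) (l e : R) :
  derivable_pt_lim f 0 l -> 0 < e ->
  exists d, 0 < d /\ forall h, Rabs h < d -> Rabs (f h - f 0 - l * h) <= e * Rabs h.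
Proof.
  intros Hf He; destruct (Hf e He) as [d Hd]; exists d; split; [apply cond_pos|].
  intros h Hh; destruct (Req_dec h 0) as [->|Hh0].
  - replace (f 0 - f 0 - l * 0) with 0 by ring; rewrite !Rabs_R0; lra.
  - specialize (Hd h Hh0 Hh); rewrite Rplus_0_l in Hd.
    replace (f h - f 0 - l * h) with (((f h - f 0) / h - l) * h) by (now field).
    rewrite Rabs_mult; apply Rmult_le_compat_r; [apply Rabs_pos | lra].
Qed.

(** The error is expanded into the first-order errors of [exp], [cos] and [sin] at 0 and the product
    [x * y]. *)
Lemma Cexp_near_0 (e : R) : 0 < e ->
  exists d, 0 < d /\ forall h, Cmod h < d -> Cmod (Cexp h - 1 - h) <= e * Cmod h.
Proof.
  intros He.
  (* The five bounds [R1] to [R5] add up to [9 * (k * m)], which [k <= e / 12] brings within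
     [e * m]; [k <= 1] gives [exp x <= 3]. *)
  pose (k := Rmin (e / 12) 1).
  assert (Hk : 0 < k) by (apply Rmin_pos; lra).
  assert (Hk1 : k <= 1) by apply Rmin_r.
  assert (Hke : k <= e / 12) by apply Rmin_l.
  destruct (derivable_pt_lim_0_bound exp 1 k derivable_pt_lim_exp_0 Hk) as (d1 & Hd1 & H1).
  assert (Hc := derivable_pt_lim_cos 0); rewrite sin_0, Ropp_0 in Hc.
  destruct (derivable_pt_lim_0_bound cos 0 k Hc Hk) as (d2 & Hd2 & H2).
  assert (Hs := derivable_pt_lim_sin 0); rewrite cos_0 in Hs.
  destruct (derivable_pt_lim_0_bound sin 1 k Hs Hk) as (d3 & Hd3 & H3).
  rewrite exp_0 in H1; rewrite cos_0 in H2; rewrite sin_0 in H3.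
  exists (Rmin (Rmin d1 d2) (Rmin d3 k)); split; [repeat apply Rmin_pos; lra|].
  intros [x y] Hh.
  assert (Hx := re_le_Cmod (x, y)); assert (Hy := Rabs_Im_le_Cmod (x, y)).
  set (m := Cmod (x, y)) in *; simpl in Hx, Hy.
  assert (Hm1 := Rlt_le_trans _ _ _ Hh (Rmin_l _ _)).
  assert (Hm2 := Rlt_le_trans _ _ _ Hh (Rmin_r _ _)).
  assert (Hm3 := Rlt_le_trans _ _ _ Hm1 (Rmin_l _ _)).
  assert (Hm4 := Rlt_le_trans _ _ _ Hm1 (Rmin_r _ _)).
  assert (Hm5 := Rlt_le_trans _ _ _ Hm2 (Rmin_l _ _)).
  assert (Hm6 := Rlt_le_trans _ _ _ Hm2 (Rmin_r _ _)).
  specialize (H1 x ltac:(lra)); specialize (H2 y ltac:(lra)); specialize (H3 y ltac:(lra)).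
  assert (Hx0 := Rabs_pos x); assert (Hy0 := Rabs_pos y).
  assert (Hex : 0 < exp x <= 3).
  { split; [apply exp_pos|]; apply Rle_trans with (exp 1); [|apply exp_le_3].
    apply Rabs_le_between in Hx.
    destruct (Rle_lt_or_eq_dec x 1); [lra| |subst; lra].
    now apply Rlt_le, exp_increasing. }
  apply Rle_trans with (1 := Cmod_le_Re_Im _).
  replace (Re (Cexp (x, y) - 1 - (x, y))) with ((exp x - 1 - 1 * x) + exp x * (cos y - 1 - 0 * y))
    by (unfold Re; simpl; ring).
  replace (Im (Cexp (x, y) - 1 - (x, y)))
    with (exp x * (sin y - 0 - 1 * y) + (exp x - 1 - 1 * x) * y + x * y)
    by (unfold Im; simpl; ring).
  assert (R1 : Rabs (exp x * (cos y - 1 - 0 * y)) <= 3 * (k * m)).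
  { rewrite Rabs_mult, (Rabs_pos_eq (exp x)) by lra.
    apply Rmult_le_compat; [lra|apply Rabs_pos|lra|nra]. }
  assert (R2 : Rabs (exp x * (sin y - 0 - 1 * y)) <= 3 * (k * m)).
  { rewrite Rabs_mult, (Rabs_pos_eq (exp x)) by lra.
    apply Rmult_le_compat; [lra|apply Rabs_pos|lra|nra]. }
  assert (R3 : Rabs (exp x - 1 - 1 * x) <= k * m) by nra.
  assert (R4 : Rabs ((exp x - 1 - 1 * x) * y) <= k * m).
  { rewrite Rabs_mult. replace (k * m) with ((k * m) * 1) by ring.
    apply Rmult_le_compat; try apply Rabs_pos; lra. }
  assert (R5 : Rabs (x * y) <= k * m).
  { rewrite Rabs_mult; apply Rmult_le_compat; lra. }
  assert (R6 := Rabs_triang (exp x - 1 - 1 * x) (exp x * (cos y - 1 - 0 * y))).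
  assert (R7 := Rabs_triang (exp x * (sin y - 0 - 1 * y) + (exp x - 1 - 1 * x) * y) (x * y)).
  assert (R8 := Rabs_triang (exp x * (sin y - 0 - 1 * y)) ((exp x - 1 - 1 * x) * y)).
  assert (R9 : k * m <= e / 12 * m) by (apply Rmult_le_compat_r; lra).
  assert (0 <= e * m) by nra.
  lra.
Qed.

(** The functional equation moves the estimate at 0 to [z]. *)
Lemma entire_Cexp : entire Cexp.
Proof.
  intros z; exists (Cexp z); apply is_cderive_iff; intros e He.
  assert (Hz : 0 < Cmod (Cexp z)) by (apply Cmod_gt_0, Cexp_neq_0).
  destruct (Cexp_near_0 (e / Cmod (Cexp z))) as (d & Hd & H); [now apply Rdiv_lt_0_compat|].
  exists d; split; [exact Hd|]; intros w Hw; specialize (H _ Hw).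
  replace (Cexp w) with (Cexp z * Cexp (w - z))%C by (rewrite <- Cexp_plus; f_equal; ring).
  replace (Cexp z * Cexp (w - z) - Cexp z - (w - z) * Cexp z)%C
    with (Cexp z * (Cexp (w - z) - 1 - (w - z)))%C by ring.
  rewrite Cmod_mult.
  replace (e * Cmod (w - z)) with (Cmod (Cexp z) * (e / Cmod (Cexp z) * Cmod (w - z)))
    by (field; lra).
  apply Rmult_le_compat_l; lra.
Qed.

(** * The maximum principle on circles *)

Lemma continuous_eps (g : R -> R) (x : R) :
  (forall e, 0 < e -> exists d, 0 < d /\ forall y, Rabs (y - x) < d -> Rabs (g y - g x) < e) ->
  continuous g x.
Proof.
  intros Hg P [e He].
  destruct (Hg e (cond_pos e)) as (d & Hd & H).
  exists (mkposreal d Hd); intros y Hy; apply He, H, Hy.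
Qed.

Lemma Cmod_pair_sub_l (x y t : R) : Cmod ((x, y) - (t, y)) = Rabs (x - t).
Proof.
  replace ((x, y) - (t, y))%C with (RtoC (x - t)) by (apply injective_projections; simpl; ring).
  apply Cmod_R.
Qed.

Lemma Cmod_pair_sub_r (x y t : R) : Cmod ((x, y) - (x, t)) = Rabs (y - t).
Proof.
  replace ((x, y) - (x, t))%C with (Ci * RtoC (y - t))%C by (apply injective_projections; simpl; ring).
  rewrite Cmod_mult, Cmod_Ci, Cmod_R; ring.
Qed.

(** Meant for [phi] among [Re], [Im], [Cmod] and for horizontal or vertical lines [gamma]. *)
Lemma continuous_along_isometry (phi : C -> R) (k : C -> C) (gamma : R -> C) (x : R) :
  (forall p q, Rabs (phi p - phi q) <= Cmod (p - q)) ->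
  (forall s t, Cmod (gamma s - gamma t) = Rabs (s - t)) ->
  entire k -> continuous (fun t => phi (k (gamma t))) x.
Proof.
  intros Hphi Hgamma Hk; apply continuous_eps; intros e He.
  destruct (ex_cderive_continuous k (gamma x) (Hk _) e He) as (r & Hr & H).
  exists r; split; [exact Hr|]; intros t Ht.
  apply Rle_lt_trans with (1 := Hphi _ _), H; now rewrite Hgamma.
Qed.

Lemma Rabs_Re_sub_le (p q : C) : Rabs (Re p - Re q) <= Cmod (p - q).
Proof. exact (re_le_Cmod (p - q)). Qed.

Lemma Rabs_Im_sub_le (p q : C) : Rabs (Im p - Im q) <= Cmod (p - q).
Proof. exact (Rabs_Im_le_Cmod (p - q)). Qed.

Lemma Rabs_Cmod_sub_le (p q : C) : Rabs (Cmod p - Cmod q) <= Cmod (p - q).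
Proof.
  assert (T1 := Cmod_triangle (p - q) q); assert (T2 := Cmod_triangle (q - p) p).
  replace (p - q + q)%C with p in T1 by ring; replace (q - p + p)%C with q in T2 by ring.
  replace (q - p)%C with (- (p - q))%C in T2 by ring; rewrite Cmod_opp in T2.
  apply Rabs_le; lra.
Qed.

(** This flux is the imaginary part of the contour integral of [k] around the rectangle. *)
Lemma flux_holomorphic (k : C -> C) (a b c d : R) :
  entire k -> a <= b -> c <= d ->
  flux (fun x y => Re (k (x, y))) (fun x y => Im (k (x, y))) a b c d = 0.
Proof.
  intros Hk; apply flux_eq_0.
  - intros x y; apply (continuous_along_isometry Re k (fun t => (x, t)));
      [exact Rabs_Re_sub_le | intros; apply Cmod_pair_sub_r | exact Hk].
  - intros x y; apply (continuous_along_isometry Im k (fun t => (t, y)));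
      [exact Rabs_Im_sub_le | intros; apply Cmod_pair_sub_l | exact Hk].
  - intros x0 y0; destruct (Hk (x0, y0)) as [[p r] Hl].
    (* With derivative [p + i r], the real part varies like [p dx - r dy] and the imaginary part
       like [r dx + p dy]. *)
    exists p, (- r), r; intros e He.
    rewrite is_cderive_iff in Hl; destruct (Hl e He) as (delta & Hdelta & H).
    exists (delta / 2); split; [lra|]; intros x y Hx Hy.
    assert (Hm := Cmod_le_Re_Im ((x, y) - (x0, y0))).
    change (Cmod ((x, y) - (x0, y0)) <= Rabs (x - x0) + Rabs (y - y0)) in Hm.
    specialize (H (x, y) ltac:(lra)).
    set (q := (k (x, y) - k (x0, y0) - ((x, y) - (x0, y0)) * (p, r))%C) in H.
    assert (Hq : Cmod q <= e * (Rabs (x - x0) + Rabs (y - y0))) by nra.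
    split; (eapply Rle_trans; [|exact Hq]).
    + eapply Rle_trans; [|apply re_le_Cmod]; right; f_equal; unfold q, Re; simpl; ring.
    + eapply Rle_trans; [|apply Rabs_Im_le_Cmod]; right; f_equal; unfold q, Im; simpl; ring.
Qed.

Lemma entire_scal (c : C) (f : C -> C) : entire f -> entire (fun z => c * f z)%C.
Proof. intros Hf; apply entire_mult; [intros z; apply ex_cderive_const | exact Hf]. Qed.

Lemma entire_comp_Cexp (g : C -> C) (z : C) : entire g -> entire (fun s => g (z + Cexp s)%C).
Proof.
  intros Hg s; apply (ex_cderive_comp g (fun s => z + Cexp s)%C); [apply Hg|].
  apply ex_cderive_plus; [apply ex_cderive_const | apply entire_Cexp].
Qed.

Lemma RInt_const_R (k a b : R) : RInt (fun _ => k) a b = (b - a) * k.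
Proof. exact (RInt_const a b k). Qed.

(* In the coordinate [s -> z + Cexp s], circles about [z] become vertical
   segments, and Goursat's theorem on [[a, x] x [0, 2 PI]] compares the means
   over two of them by periodicity; let [a] tend to minus infinity. *)
Lemma Cmod_le_on_circle (g : C -> C) (z : C) (x M : R) : entire g ->
  (forall y, Cmod (g (z + Cexp (x, y))%C) <= M) -> Cmod (g z) <= M.
Proof.
  intros Hg HM.
  (* The factor makes the value at the centre the real number [Cmod (g z) ^ 2], so that real parts
     suffice. *)
  pose (k := fun s => (Cconj (g z) * g (z + Cexp s))%C).
  assert (Hk : entire k) by now apply entire_scal, entire_comp_Cexp.
  assert (Hmean : forall e, 0 < e -> Cmod (g z) * Cmod (g z) <= Cmod (g z) * M + e).
  { intros e He.
    assert (Hlim : exists d, 0 < d /\ forall w, Cmod (w - z) < d ->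
       Cmod (Cconj (g z) * g w - Cconj (g z) * g z) < e)
      by (apply (ex_cderive_continuous (fun w => Cconj (g z) * g w)%C);
          [now apply entire_scal | exact He]).
    destruct Hlim as (d & Hd & Hlim).
    (* The inner circle has radius [exp a], below [d] and not above the outer radius. *)
    pose (a := Rmin x (ln (d / 2))).
    assert (Hax : a <= x) by apply Rmin_l.
    assert (Had : exp a < d).
    { apply Rle_lt_trans with (exp (ln (d / 2))); [|rewrite exp_ln; lra].
      destruct (Rle_lt_or_eq_dec a (ln (d / 2)) (Rmin_r _ _)) as [H|H];
        [now apply Rlt_le, exp_increasing | rewrite H; lra]. }
    assert (HPI := PI_RGT_0).
    assert (Hfl := flux_holomorphic k a x 0 (2 * PI) Hk Hax ltac:(lra)).
    (* The two horizontal sides cancel by periodicity. *)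
    unfold flux in Hfl; rewrite (RInt_ext _ (fun _ => 0) a x) in Hfl.
    2: { intros t _; unfold k, Cexp; simpl.
         rewrite cos_2PI, sin_2PI, cos_0, sin_0; ring. }
    rewrite RInt_const_R in Hfl.
    assert (Hle : RInt (fun y => Re (k (x, y)) - Re (k (a, y))) 0 (2 * PI) <=
                  RInt (fun _ => Cmod (g z) * M - Cmod (g z) * Cmod (g z) + e) 0 (2 * PI)).
    { apply RInt_le; [lra| |apply ex_RInt_continuous_fun; intros y; apply continuous_const|].
      - apply ex_RInt_continuous_fun; intros y; apply (continuous_minus (V := R_NormedModule)).
        + apply (continuous_along_isometry Re k (fun t => (x, t)));
            [exact Rabs_Re_sub_le | intros; apply Cmod_pair_sub_r | exact Hk].
        + apply (continuous_along_isometry Re k (fun t => (a, t)));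
            [exact Rabs_Re_sub_le | intros; apply Cmod_pair_sub_r | exact Hk].
      - intros y _.
        assert (H1 : Re (k (x, y)) <= Cmod (g z) * M).
        { eapply Rle_trans; [apply Rle_abs|]; eapply Rle_trans; [apply re_le_Cmod|].
          unfold k; rewrite Cmod_mult, Cmod_conj.
          apply Rmult_le_compat_l; [apply Cmod_ge_0 | apply HM]. }
        assert (H2 : Rabs (Re (k (a, y) - Cconj (g z) * g z)) <= e).
        { eapply Rle_trans; [apply re_le_Cmod|]; apply Rlt_le, Hlim.
          replace (z + Cexp (a, y) - z)%C with (Cexp (a, y)) by ring.
          now rewrite Cmod_Cexp. }
        replace (Re (k (a, y) - Cconj (g z) * g z))
          with (Re (k (a, y)) - Cmod (g z) ^ 2) in H2
          by (rewrite Cmod2_alt; unfold Re, Im; simpl; ring).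
        apply Rabs_le_between in H2; nra. }
    rewrite RInt_const_R in Hle.
    apply Rnot_lt_le; intros Hlt; nra. }
  destruct (Rle_lt_dec (Cmod (g z)) M) as [H|H]; [exact H|exfalso].
  assert (H0 : 0 <= M) by (eapply Rle_trans; [apply Cmod_ge_0 | apply (HM 0)]).
  (* Half of the excess of [Cmod (g z) ^ 2] over [Cmod (g z) * M], positive because
     [0 <= M < Cmod (g z)]. *)
  specialize (Hmean (Cmod (g z) * (Cmod (g z) - M) / 2)).
  nra.
Qed.

Lemma Cexp_period (x y : R) (n : Z) : Cexp (x, y) = Cexp (x, y + 2 * IZR n * PI).
Proof.
  unfold Cexp; simpl.
  destruct (Z_le_gt_dec 0 n) as [Hn|Hn].
  - rewrite <- (Z2Nat.id n Hn), <- INR_IZR_INZ, cos_period, sin_period; reflexivity.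
  - set (y' := y + 2 * IZR n * PI).
    assert (E : y = y' + 2 * INR (Z.to_nat (- n)) * PI).
    { rewrite INR_IZR_INZ, Z2Nat.id, opp_IZR by lia; unfold y'; ring. }
    rewrite E, cos_period, sin_period; reflexivity.
Qed.

(** A maximum exists on the angles from 0 to [2 * PI], and every angle reduces to one of these. *)
Lemma bounded_on_circle (g : C -> C) (z : C) (x : R) : entire g ->
  exists M, forall y, Cmod (g (z + Cexp (x, y))%C) <= M.
Proof.
  intros Hg.
  assert (Hc : forall y, continuous (fun t => Cmod (g (z + Cexp (x, t))%C)) y).
  { intros y; apply (continuous_along_isometry Cmod (fun s => g (z + Cexp s)%C) (fun t => (x, t)));
      [exact Rabs_Cmod_sub_le | intros; apply Cmod_pair_sub_r | now apply entire_comp_Cexp]. }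
  assert (HPI := PI_RGT_0).
  destruct (continuity_ab_maj (fun t => Cmod (g (z + Cexp (x, t))%C)) 0 (2 * PI)) as (ym & Hym & _).
  - lra.
  - intros c _; apply continuity_pt_filterlim, Hc.
  - exists (Cmod (g (z + Cexp (x, ym))%C)); intros y.
    destruct (archimed (y / (2 * PI))) as [Ha1 Ha2].
    pose (n := (up (y / (2 * PI)) - 1)%Z).
    assert (Hn : IZR n = IZR (up (y / (2 * PI))) - 1) by (unfold n; now rewrite minus_IZR).
    pose (y' := y - IZR n * (2 * PI)).
    assert (Hy : y = y / (2 * PI) * (2 * PI)) by (field; lra).
    assert (Hy' : 0 <= y' <= 2 * PI) by (unfold y'; nra).
    replace (Cexp (x, y)) with (Cexp (x, y')); [now apply Hym|].
    assert (E : y = y' + 2 * IZR n * PI) by (unfold y'; ring).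
    rewrite E; apply Cexp_period.
Qed.

(** * The identity theorem *)

Lemma Cmod_sub_diag (z : C) : Cmod (z - z) = 0.
Proof. replace (z - z)%C with (RtoC 0) by ring; apply Cmod_0. Qed.

Lemma Cminus_eq_0 (z w : C) : (z - w = 0)%C -> z = w.
Proof. intros E; rewrite <- (Cplus_0_l w), <- E; ring. Qed.

Lemma ex_cderive_ext_loc (f g : C -> C) (z : C) (r : R) : 0 < r ->
  (forall w, Cmod (w - z) < r -> f w = g w) -> ex_cderive f z -> ex_cderive g z.
Proof.
  intros Hr Hfg [l Hl]; exists l; rewrite is_cderive_iff in *; intros e He.
  destruct (Hl e He) as (d & Hd & H).
  exists (Rmin d r); split; [now apply Rmin_pos|]; intros w Hw.
  rewrite <- !Hfg.
  - apply H, Rlt_le_trans with (1 := Hw), Rmin_l.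
  - now rewrite Cmod_sub_diag.
  - apply Rlt_le_trans with (1 := Hw), Rmin_r.
Qed.

(** Near [p] the quotient is constantly 0, whatever value [/ 0] takes; elsewhere the denominator is
    nonzero. *)
Lemma entire_div_sub (g : C -> C) (p : C) (r : R) : 0 < r -> entire g ->
  (forall w, Cmod (w - p) < r -> g w = 0) -> entire (fun w => g w / (w - p))%C.
Proof.
  intros Hr Hg H0 z; destruct (classic (z = p)) as [->|Hzp].
  - apply (ex_cderive_ext_loc (fun _ => RtoC 0) _ p r Hr); [|apply ex_cderive_const].
    intros w Hw; rewrite (H0 w Hw); unfold Cdiv; ring.
  - apply ex_cderive_mult; [apply Hg|].
    apply (ex_cderive_comp Cinv (fun w => w - p)%C).
    + apply ex_cderive_inv; intros E; now apply Hzp, Cminus_eq_0.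
    + apply ex_cderive_minus; [apply ex_cderive_id | apply ex_cderive_const].
Qed.

(* Dividing by [w - p] keeps [g] entire, and costs a factor at least [2 rho] on
   the circle of radius [3 rho] about [z], but only [rho] at [z]. *)
Lemma Cmod_le_geometric (p z : C) (r : R) : 0 < r -> z <> p ->
  forall (n : nat) (g : C -> C) (M : R), entire g ->
  (forall w, Cmod (w - p) < r -> g w = 0) ->
  (forall y, Cmod (g (z + Cexp (ln (3 * Cmod (z - p)), y))%C) <= M) ->
  Cmod (g z) <= M / 2 ^ n.
Proof.
  intros Hr Hzp.
  assert (Hneq : (z - p)%C <> 0).
  { intros E; now apply Hzp, Cminus_eq_0. }
  assert (Hrho : 0 < Cmod (z - p)) by now apply Cmod_gt_0.
  set (rho := Cmod (z - p)) in *.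
  induction n as [|n IH]; intros g M Hg H0 HM.
  - rewrite pow_O, Rdiv_1_r; now apply (Cmod_le_on_circle g z (ln (3 * rho))).
  - assert (Hz : Cmod (g z / (z - p)) <= M / (2 * rho) / 2 ^ n).
    { apply (IH (fun w => g w / (w - p))%C).
      - now apply (entire_div_sub g p r).
      - intros w Hw; rewrite (H0 w Hw); unfold Cdiv; ring.
      - intros y; specialize (HM y).
        set (E := Cexp (ln (3 * rho), y)) in *.
        assert (HE : Cmod E = 3 * rho).
        { unfold E; rewrite Cmod_Cexp; apply exp_ln; lra. }
        assert (Hfar : 2 * rho <= Cmod (z + E - p)).
        { assert (T := Cmod_triangle (z + E - p) (- (z - p))).
          replace (z + E - p + - (z - p))%C with E in T by ring.
          rewrite Cmod_opp in T; fold rho in T; lra. }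
        rewrite Cmod_div by (apply (proj2 (Cmod_gt_0 _)); lra).
        apply Rle_div_l; [lra|].
        assert (HM0 := Cmod_ge_0 (g (z + E)%C)).
        apply Rle_trans with (M / (2 * rho) * (2 * rho)).
        + replace (M / (2 * rho) * (2 * rho)) with M by (field; lra); exact HM.
        + apply Rmult_le_compat_l; [|exact Hfar].
          apply Rmult_le_pos; [lra | apply Rlt_le, Rinv_0_lt_compat; lra]. }
    rewrite Cmod_div in Hz by assumption; fold rho in Hz.
    apply (Rmult_le_compat_r rho) in Hz; [|lra].
    assert (H2 : 2 ^ n <> 0) by (apply pow_nonzero; lra).
    replace (Cmod (g z) / rho * rho) with (Cmod (g z)) in Hz by (field; lra).
    replace (M / (2 * rho) / 2 ^ n * rho) with (M / 2 ^ S n) in Hz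
      by (simpl; field; split; lra).
    exact Hz.
Qed.

(** With [M] a bound for [g] on the circle of radius [3 * Cmod (z - p)] about [z], the bounds
    [M / 2 ^ n] tend to 0. *)
Lemma entire_zero_disc (g : C -> C) (p : C) (r : R) : 0 < r -> entire g ->
  (forall w, Cmod (w - p) < r -> g w = 0) -> forall z, g z = 0.
Proof.
  intros Hr Hg H0 z; destruct (classic (z = p)) as [->|Hzp].
  - apply H0; now rewrite Cmod_sub_diag.
  - destruct (bounded_on_circle g z (ln (3 * Cmod (z - p))) Hg) as [M HM].
    assert (Hn : forall n, Cmod (g z) <= M / 2 ^ n)
      by (intros n; now apply (Cmod_le_geometric p z r)).
    apply Cmod_eq_0; apply Rle_antisym; [|apply Cmod_ge_0].
    apply Rnot_lt_le; intros Hpos.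
    assert (HM0 : 0 < M).
    { specialize (Hn 0%nat); rewrite pow_O, Rdiv_1_r in Hn; lra. }
    destruct (pow_lt_1_zero (/ 2)) with (y := Cmod (g z) / M) as [N HN].
    + rewrite Rabs_pos_eq; lra.
    + now apply Rdiv_lt_0_compat.
    + specialize (HN N (Nat.le_refl N)); specialize (Hn N).
      rewrite pow_inv in HN.
      assert (HpN : 0 < / 2 ^ N) by (apply Rinv_0_lt_compat, pow_lt; lra).
      rewrite Rabs_pos_eq in HN by lra.
      apply (Rmult_lt_compat_l M) in HN; [|lra].
      replace (M * (Cmod (g z) / M)) with (Cmod (g z)) in HN by (field; lra).
      unfold Rdiv in Hn; lra.
Qed.

(** If [g] is nonzero at a point, it is nonzero on a disc around it, where [f] must then vanish. *)
Lemma entire_mult_eq_0 (f g : C -> C) : entire f -> entire g ->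
  (forall z, f z * g z = 0)%C -> (forall z, f z = 0) \/ (forall z, g z = 0).
Proof.
  intros Hf Hg Hfg.
  destruct (classic (forall z, g z = 0)) as [H|H]; [now right|left].
  apply not_all_ex_not in H; destruct H as [p Hp].
  destruct (ex_cderive_continuous g p (Hg p) (Cmod (g p))) as (d & Hd & Hc);
    [now apply Cmod_gt_0|].
  apply (entire_zero_disc f p d Hd Hf); intros w Hw; specialize (Hc w Hw).
  destruct (classic (f w = 0)) as [E|E]; [exact E|exfalso].
  assert (Hgw : g w = 0).
  { destruct (classic (g w = 0)) as [E'|E']; [exact E'|exfalso].
    now apply (Cmult_neq_0 _ _ E E'). }
  rewrite Hgw in Hc; replace (0 - g p)%C with (- g p)%C in Hc by ring.
  rewrite Cmod_opp in Hc; lra.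
Qed.

(* The function equal to [f] above the real line and to [0] below it is entire. *)
Lemma entire_zero_upper (f : C -> C) : entire f -> (forall x : R, f (RtoC x) = 0) ->
  forall z, 0 < Im z -> f z = 0.
Proof.
  intros Hf H0 z Hz.
  pose (g := fun w => if Rlt_dec 0 (Im w) then f w else RtoC 0).
  assert (Hgz : g z = 0).
  2: { unfold g in Hgz; now destruct (Rlt_dec 0 (Im z)). }
  assert (Him : forall v w, Rabs (Im w - Im v) <= Cmod (w - v))
    by (intros v w; exact (Rabs_Im_le_Cmod (w - v))).
  (* The unit disc about [- Ci] lies in the lower half-plane, where [g] is 0. *)
  apply (entire_zero_disc g (- Ci) 1); [lra| |].
  2: { intros w Hw; unfold g; destruct (Rlt_dec 0 (Im w)) as [H|H]; [|reflexivity].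
       assert (B := Him (- Ci)%C w); apply Rabs_le_between in B; simpl in B; lra. }
  intros v; destruct (Rtotal_order (Im v) 0) as [Hv|[Hv|Hv]].
  - apply (ex_cderive_ext_loc (fun _ => RtoC 0) _ v (- Im v)); [lra| |apply ex_cderive_const].
    intros w Hw; unfold g; destruct (Rlt_dec 0 (Im w)) as [H|H]; [|reflexivity].
    assert (B := Him v w); apply Rabs_le_between in B; lra.
  - assert (Ev : v = RtoC (Re v)).
    { destruct v as [a b]; simpl in Hv |- *; now rewrite Hv. }
    destruct (Hf v) as [l Hl]; rewrite is_cderive_iff in Hl.
    assert (Hfv : f v = 0) by (rewrite Ev; apply H0).
    (* Along the real line the difference quotients of [f] at [v] are 0, hence so is its
       derivative. *)
    assert (Hl0 : l = RtoC 0 :> C).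
    { apply Cmod_eq_0, Rle_antisym; [|apply Cmod_ge_0].
      apply Rle_plus_epsilon; intros e He; rewrite Rplus_0_l.
      destruct (Hl e He) as (d & Hd & H).
      assert (Hh : Cmod (RtoC (Re v + d / 2) - v) = d / 2).
      { rewrite Ev at 2; rewrite <- RtoC_minus, Cmod_R, Rabs_pos_eq; lra. }
      specialize (H (RtoC (Re v + d / 2)) ltac:(lra)).
      rewrite H0, Hfv in H.
      replace (0 - 0 - (RtoC (Re v + d / 2) - v) * l)%C
        with (- ((RtoC (Re v + d / 2) - v) * l))%C in H by ring.
      rewrite Cmod_opp, Cmod_mult, Hh in H; nra. }
    (* With derivative 0, the estimate for [f] passes to [g], whose values are those of [f] or 0. *)
    exists (RtoC 0); apply is_cderive_iff; intros e He.
    destruct (Hl e He) as (d & Hd & H); exists d; split; [exact Hd|].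
    intros w Hw; specialize (H w Hw); subst l; rewrite Hfv in H.
    assert (Hgv : g v = 0) by (unfold g; destruct (Rlt_dec 0 (Im v)); [exact Hfv|reflexivity]).
    rewrite Hgv; unfold g; destruct (Rlt_dec 0 (Im w)); [exact H|].
    replace (0 - 0 - (w - v) * 0)%C with (RtoC 0) by ring.
    rewrite Cmod_0; apply Rmult_le_pos; [lra | apply Cmod_ge_0].
  - apply (ex_cderive_ext_loc f _ v (Im v)); [lra| |apply Hf].
    intros w Hw; unfold g; destruct (Rlt_dec 0 (Im w)) as [H|H]; [reflexivity|].
    assert (B := Him v w); apply Rabs_le_between in B; lra.
Qed.

Lemma entire_zero_real (f : C -> C) : entire f -> (forall x : R, f (RtoC x) = 0) ->
  forall z, f z = 0.
Proof.
  intros Hf H0 z; destruct (Rtotal_order (Im z) 0) as [Hz|[Hz|Hz]].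
  (* The lower half-plane is the upper one for the function [f (- w)]. *)
  - assert (E := entire_zero_upper (fun w => f (- 1 * w + 0)%C)
      (entire_comp_affine f (- 1)%C 0 Hf)).
    replace z with (- 1 * (- z) + 0)%C by ring.
    apply E; [|change (0 < - Im z); lra].
    intros x; replace (- 1 * x + 0)%C with (RtoC (- x)) by (rewrite RtoC_opp; ring); apply H0.
  - replace z with (RtoC (Re z)); [apply H0|].
    destruct z as [a b]; simpl in Hz |- *; now rewrite Hz.
  - now apply entire_zero_upper.
Qed.

Lemma entire_zero_line (f : C -> C) (a b : C) : entire f -> a <> 0 ->
  (forall x : R, f (a * x + b)%C = 0) -> forall z, f z = 0.
Proof.
  intros Hf Ha H0 z.
  replace z with (a * ((z - b) / a) + b)%C by (now field).
  apply (entire_zero_real (fun w => f (a * w + b)%C)); [now apply entire_comp_affine | exact H0].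
Qed.

(** * Subgroups of the real line *)

Lemma subgroup_multiples (P : R -> Prop) (t : R) (n : Z) :
  P 0 -> (forall x y, P x -> P y -> P (x - y)) -> P t -> P (t * IZR n).
Proof.
  intros P0 Psub Pt.
  assert (Hnat : forall k : nat, P (t * INR k)).
  { induction k as [|k IH]; [now rewrite Rmult_0_r|].
    replace (t * INR (S k)) with (t * INR k - (0 - t)) by (rewrite S_INR; ring); auto. }
  destruct (Z_le_gt_dec 0 n) as [Hn|Hn].
  - rewrite <- (Z2Nat.id n Hn), <- INR_IZR_INZ; apply Hnat.
  - replace (t * IZR n) with (0 - t * INR (Z.to_nat (- n))); [auto|].
    rewrite INR_IZR_INZ, Z2Nat.id, opp_IZR by lia; ring.
Qed.

Lemma floor_multiple (t s : R) : 0 < t -> exists n : Z, 0 <= s - t * IZR n < t.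
Proof.
  intros Ht; destruct (archimed (s / t)) as [H1 H2].
  exists (up (s / t) - 1)%Z; rewrite minus_IZR.
  assert (E : s = s / t * t) by (field; lra).
  split; nra.
Qed.

(** If there are arbitrarily small positive elements, their multiples approximate every real.
    Otherwise a least positive element, if any is positive, generates the group by division with
    remainder. *)
Lemma subgroup_cyclic_or_dense (P : R -> Prop) :
  P 0 -> (forall x y, P x -> P y -> P (x - y)) ->
  (exists a, forall t, P t -> exists n : Z, t = a * IZR n) \/
  (forall s e, 0 < e -> exists t, P t /\ Rabs (t - s) < e).
Proof.
  intros P0 Psub.
  destruct (classic (forall e, 0 < e -> exists t, P t /\ 0 < t < e)) as [Hsmall|Hgap].
  - right; intros s e He; destruct (Hsmall e He) as (t & Pt & Ht).
    destruct (floor_multiple t s) as [n Hn]; [lra|].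
    exists (t * IZR n); split; [now apply subgroup_multiples|].
    apply Rabs_lt_between; lra.
  - left; apply not_all_ex_not in Hgap; destruct Hgap as [e Hgap].
    apply imply_to_and in Hgap; destruct Hgap as [He Hgap].
    destruct (classic (exists t, P t /\ 0 < t)) as [[t1 [Pt1 Ht1]]|Hnone].
    (* [- M] is the infimum of the positive elements. *)
    + destruct (completeness (fun x => P (- x) /\ 0 < - x)) as [M [HMub HMlub]].
      * exists 0; intros x [_ Hx]; lra.
      * exists (- t1); rewrite Ropp_involutive; now split.
      * destruct (classic (exists t, P t /\ 0 < t < - M + e)) as [(t0 & Pt0 & Ht0)|Hfar].
        (* A positive element below [t0] would differ from it by less than [e], against [Hgap]. *)
        -- assert (Hmin : forall t, P t -> 0 < t -> t0 <= t).
           { intros t Pt Ht; apply Rnot_lt_le; intros Hlt; apply Hgap.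
             assert (HtM : - t <= M) by (apply HMub; rewrite Ropp_involutive; now split).
             exists (t0 - t); split; [now apply Psub | lra]. }
           exists t0; intros t Pt; destruct (floor_multiple t0 t) as [n Hn]; [lra|].
           exists n.
           destruct (Rle_lt_or_eq_dec 0 (t - t0 * IZR n)) as [Hlt|Heq]; [lra| |lra].
           assert (Pr : P (t - t0 * IZR n)) by (apply Psub; [exact Pt | now apply subgroup_multiples]).
           specialize (Hmin _ Pr Hlt); lra.
        (* With no element in that range, [M - e] would be an upper bound too. *)
        -- exfalso; assert (HM : M <= M - e); [|lra].
           apply HMlub; intros x [Px Hx]; apply Rnot_lt_le; intros Hlt.
           apply Hfar; exists (- x); split; [exact Px | lra].
    + exists 0; intros t Pt; exists 0%Z; rewrite Rmult_0_l.
      destruct (Rtotal_order t 0) as [H|[H|H]]; [exfalso|exact H|exfalso]; apply Hnone.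
      * exists (0 - t); split; [now apply Psub | lra].
      * exists t; now split.
Qed.

(** * Common imaginary periods *)

Lemma entire_translate (f : C -> C) (b : C) : entire f -> entire (fun z => f (z + b)%C).
Proof.
  intros Hf z; apply (ex_cderive_comp f (fun w => w + b)%C); [apply Hf|].
  apply ex_cderive_plus; [apply ex_cderive_id | apply ex_cderive_const].
Qed.

Lemma entire_mult_cancel (f g : C -> C) : entire f -> entire g ->
  ~ (forall z, g z = 0) -> (forall z, g z * f z = 0)%C -> forall z, f z = 0.
Proof.
  intros Hf Hg Hg0 H.
  destruct (entire_mult_eq_0 g f Hg Hf H) as [H1|H1]; [contradiction | exact H1].
Qed.

(* [i t] is a period of [f / h], written without division. *)
Definition common_period (f h : C -> C) (t : R) : Prop :=
  forall z : C, (f (z + Ci * t) * h z)%C = (h (z + Ci * t) * f z)%C.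

Section CommonPeriods.

Context (f h : C -> C) (Hf : entire f) (Hh : entire h) (Hh0 : ~ (forall z, h z = 0)).

Lemma common_period_0 : common_period f h 0.
Proof. intros z; replace (z + Ci * 0)%C with z by ring; ring. Qed.

(** With [v = w - i t], both hypotheses at [v] compare [f / h] at [w + i (s - t)] and at [w] with
    its value at [v]. To avoid dividing, the claim is multiplied by [h v], which is cancelled as a
    nonzero entire function. *)
Lemma common_period_sub (s t : R) :
  common_period f h s -> common_period f h t -> common_period f h (s - t).
Proof.
  intros Ps Pt z; apply Cminus_eq_0.
  apply (entire_mult_cancel
    (fun z => f (z + Ci * RtoC (s - t)) * h z - h (z + Ci * RtoC (s - t)) * f z)%C
    (fun z => h (z + - (Ci * t))%C)).
  - apply entire_minus; apply entire_mult; auto using entire_translate.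
  - now apply entire_translate.
  - intros H; apply Hh0; intros w; replace w with (w + Ci * t + - (Ci * t))%C by ring; apply H.
  - intros w; set (v := (w + - (Ci * t))%C).
    assert (Es := Ps v); assert (Et := Pt v).
    replace (v + Ci * t)%C with w in Et by (unfold v; ring).
    replace (v + Ci * s)%C with (w + Ci * RtoC (s - t))%C in Es
      by (unfold v; rewrite RtoC_minus; ring).
    replace (h v * (f (w + Ci * RtoC (s - t)) * h w - h (w + Ci * RtoC (s - t)) * f w))%C
      with (f (w + Ci * RtoC (s - t)) * h v * h w - h (w + Ci * RtoC (s - t)) * (f w * h v))%C
      by ring.
    rewrite Es, Et; ring.
Qed.

Lemma proportional_of_dense_periods :
  (forall s e, 0 < e -> exists t, common_period f h t /\ Rabs (t - s) < e) ->
  exists c : C, forall z, f z = (c * h z)%C.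
Proof.
  intros Hdense.
  apply not_all_ex_not in Hh0; destruct Hh0 as [z0 Hz0].
  exists (f z0 / h z0)%C.
  (* [G] vanishes at the real numbers that are common periods, hence on the real line by density and
     continuity, hence everywhere. *)
  pose (G := fun w => (f (Ci * w + z0) * h z0 - h (Ci * w + z0) * f z0)%C).
  assert (HG : entire G).
  { apply entire_minus; apply entire_mult; auto using entire_comp_affine;
    intros z; apply ex_cderive_const. }
  assert (HGP : forall t, common_period f h t -> G (RtoC t) = 0).
  { intros t Pt; unfold G; rewrite Cplus_comm, (Pt z0); ring. }
  assert (HG0 : forall w, G w = 0).
  { apply entire_zero_real; [exact HG|]; intros s.
    destruct (classic (G (RtoC s) = 0)) as [E|E]; [exact E|exfalso].
    destruct (ex_cderive_continuous G s (HG s) (Cmod (G s))) as (d & Hd & Hc);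
      [now apply Cmod_gt_0|].
    destruct (Hdense s d Hd) as (t & Pt & Ht).
    specialize (Hc (RtoC t)); rewrite <- RtoC_minus, Cmod_R in Hc; specialize (Hc Ht).
    rewrite (HGP t Pt) in Hc; replace (0 - G s)%C with (- G s)%C in Hc by ring.
    rewrite Cmod_opp in Hc; lra. }
  intros z; specialize (HG0 (- Ci * (z - z0))%C); unfold G in HG0.
  replace (Ci * (- Ci * (z - z0)) + z0)%C with z in HG0.
  - apply Cminus_eq_0 in HG0.
    replace (f z0 / h z0 * h z)%C with ((h z * f z0) / h z0)%C by (field; exact Hz0).
    rewrite <- HG0; field; exact Hz0.
  - replace (Ci * (- Ci * (z - z0)))%C with (- (Ci * Ci) * (z - z0))%C by ring.
    replace (Ci * Ci)%C with (- RtoC 1)%C by (apply injective_projections; simpl; ring).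
    ring.
Qed.

End CommonPeriods.

(** * Uniqueness from moduli on horizontal lines *)

(** By [M 0] the real line is one of the lines, so a progression containing [M] consists of the
    multiples of its step. *)
Lemma phase_equiv_of_parallel_lines (f h : C -> C) (M : R -> Prop) :
  entire f -> entire h -> M 0 ->
  (forall x mu : R, M mu -> Cmod (f (x + Ci * mu)%C) = Cmod (h (x + Ci * mu)%C)) ->
  ~ (exists a, forall mu, M mu -> exists n : Z, mu = a * IZR n) ->
  phase_equiv f h.
Proof.
  intros Hf Hh M0 Hmod HM.
  pose (fc := fun z => Cconj (f (Cconj z))).
  pose (hc := fun z => Cconj (h (Cconj z))).
  assert (Hfc : entire fc) by now apply entire_conj.
  assert (Hhc : entire hc) by now apply entire_conj.
  assert (Hshift : forall mu, M mu -> forall z,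
    (f (z + Ci * RtoC (2 * mu)) * fc z = h (z + Ci * RtoC (2 * mu)) * hc z)%C).
  { intros mu Hmu z; apply Cminus_eq_0.
    apply (entire_zero_line (fun z => f (z + Ci * RtoC (2 * mu)) * fc z
      - h (z + Ci * RtoC (2 * mu)) * hc z)%C 1 (- (Ci * mu))%C).
    - apply entire_minus; apply entire_mult; auto using entire_translate.
    - intros E; apply RtoC_inj in E; lra.
    - intros x; unfold fc, hc.
      replace (1 * x + - (Ci * mu) + Ci * RtoC (2 * mu))%C with (x + Ci * mu)%C
        by (rewrite RtoC_mult; ring).
      replace (Cconj (1 * x + - (Ci * mu)))%C with (x + Ci * mu)%C
        by (apply injective_projections; simpl; ring).
      rewrite <- !Cmod2_conj, (Hmod x mu Hmu); ring. }
  assert (H1 : forall z, (f z * fc z = h z * hc z)%C).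
  { intros z; rewrite <- (Cplus_0_r z) at 1 3.
    replace (RtoC 0) with (Ci * RtoC (2 * 0))%C by (rewrite Rmult_0_r; ring).
    now apply Hshift. }
  destruct (classic (forall z, h z = 0)) as [Hh0|Hh0].
  - exists (RtoC 1); split; [apply Cmod_1|]; intros z; rewrite Hh0, Cmult_0_r.
    destruct (entire_mult_eq_0 f fc Hf Hfc) as [H|H]; [|apply H|].
    + intros w; rewrite H1, Hh0; ring.
    + specialize (H (Cconj z)); unfold fc in H; rewrite Cconj_conj in H.
      rewrite <- (Cconj_conj (f z)), H; apply injective_projections; simpl; ring.
  - assert (Hhc0 : ~ (forall z, hc z = 0)).
    { intros H; apply Hh0; intros z.
      specialize (H (Cconj z)); unfold hc in H; rewrite Cconj_conj in H.
      rewrite <- (Cconj_conj (h z)), H; apply injective_projections; simpl; ring. }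
    assert (Hper : forall mu, M mu -> common_period f h (2 * mu)).
    (* After multiplication by [hc], [H1] turns [h * hc] into [f * fc], and [Hshift] does the
       rest. *)
    { intros mu Hmu z; apply Cminus_eq_0.
      apply (entire_mult_cancel (fun z => f (z + Ci * RtoC (2 * mu)) * h z
        - h (z + Ci * RtoC (2 * mu)) * f z)%C hc); auto.
      - apply entire_minus; apply entire_mult; auto using entire_translate.
      - intros w.
        replace (hc w * (f (w + Ci * RtoC (2 * mu)) * h w - h (w + Ci * RtoC (2 * mu)) * f w))%C
          with (f (w + Ci * RtoC (2 * mu)) * (h w * hc w)
                - (h (w + Ci * RtoC (2 * mu)) * hc w) * f w)%C by ring.
        rewrite <- H1, <- (Hshift mu Hmu); ring. }
    destruct (subgroup_cyclic_or_dense (common_period f h)) as [[a Ha]|Hdense].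
    + apply common_period_0.
    + intros s t; now apply common_period_sub.
    + exfalso; apply HM; exists (a / 2); intros mu Hmu.
      destruct (Ha _ (Hper mu Hmu)) as [n Hn]; exists n; lra.
    + destruct (proportional_of_dense_periods f h Hf Hh Hh0 Hdense) as [c Hc].
      exists c; split; [|exact Hc].
      (* The modulus of [c] is read off at a real point where [h] is nonzero. *)
      destruct (classic (forall x : R, h x = 0)) as [H|H].
      * exfalso; apply Hh0; now apply entire_zero_real.
      * apply not_all_ex_not in H; destruct H as [x Hx].
        assert (E := Hmod x 0 M0).
        replace (x + Ci * 0)%C with (RtoC x) in E by ring.
        rewrite Hc, Cmod_mult in E.
        apply Cmod_gt_0 in Hx.
        apply (Rmult_eq_reg_r (Cmod (h x))); lra.
Qed.

(** * The two directions of the equivalence *)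

Lemma Cexp_0 : Cexp 0 = 1.
Proof.
  unfold Cexp; simpl; rewrite exp_0, cos_0, sin_0; apply injective_projections; simpl; ring.
Qed.

Lemma Cexp_opp_r (z : C) : (Cexp z * Cexp (- z) = 1)%C.
Proof. rewrite <- Cexp_plus, <- Cexp_0; f_equal; ring. Qed.

(** The map [w -> u * (w + Ci * l0)] carries horizontal lines to the given ones, and the real line
    to the one of index [l0]. *)
Lemma uniqueness_of_no_progression (F : (C -> C) -> Prop) (theta : R) (Lambda : R -> Prop) :
  (forall f, F f -> entire f) ->
  ~ (exists a b : R,
       forall lambda : R, Lambda lambda -> arithmetic_progression a b lambda) ->
  phase_uniqueness_set (rotated_lines theta Lambda) F.
Proof.
  intros HF HL f h Ff Fh Hmod.
  destruct (classic (exists l0, Lambda l0)) as [[l0 Hl0]|Hempty].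
  (* An empty [Lambda] lies in every progression. *)
  2: { exfalso; apply HL; exists 0, 0; intros l Hl; exfalso; apply Hempty; now exists l. }
  set (u := Cexp (Ci * RtoC theta)) in *.
  assert (Hu : u <> 0) by apply Cexp_neq_0.
  destruct (phase_equiv_of_parallel_lines
    (fun w => f (u * w + u * (Ci * l0))%C) (fun w => h (u * w + u * (Ci * l0))%C)
    (fun mu => Lambda (mu + l0))) as (c & Hc1 & Hc).
  - now apply entire_comp_affine, HF.
  - now apply entire_comp_affine, HF.
  - now rewrite Rplus_0_l.
  - intros x mu Hmu.
    replace (u * (x + Ci * mu) + u * (Ci * l0))%C with (u * (x + Ci * RtoC (mu + l0)))%C
      by (rewrite RtoC_plus; ring).
    apply Hmod; now exists x, (mu + l0).
  - intros [a Ha]; apply HL; exists a, l0; intros l Hl.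
    destruct (Ha (l - l0)) as [n Hn]; [now replace (l - l0 + l0) with l by ring|].
    exists n; lra.
  - exists c; split; [exact Hc1|]; intros z; specialize (Hc (z / u - Ci * l0)%C); cbv beta in Hc.
    now replace (u * (z / u - Ci * l0) + u * (Ci * l0))%C with z in Hc by (now field).
Qed.

(* With [E = e^(xi z + kappa)] real on all the lines, [E + i E^2] and
   [E - i E^2] are conjugate there; the former alone vanishes where [E = i]. *)
Lemma not_uniqueness_of_progression (F : (C -> C) -> Prop) (theta a b : R)
  (Lambda : R -> Prop) :
  entire_function_space F ->
  (forall xi : C, xi <> RtoC 0 -> F (fun z : C => Cexp (xi * z)%C)) ->
  a <> 0 -> (forall lambda, Lambda lambda -> arithmetic_progression a b lambda) ->
  ~ phase_uniqueness_set (rotated_lines theta Lambda) F.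
Proof.
  intros HF Hexp Ha HL Huniq.
  assert (HPI := PI_RGT_0).
  (* On the line of index [a * n + b] the exponent becomes [beta * x + i n PI], as [kappa] absorbs
     the offset [b]; so [E] is real there. *)
  pose (beta := PI / a).
  assert (Hbeta : beta <> 0).
  { unfold beta, Rdiv; apply Rmult_integral_contrapositive_currified;
    [lra | now apply Rinv_neq_0_compat]. }
  pose (xi := (RtoC beta * Cexp (- (Ci * RtoC theta)))%C).
  assert (Hxi : xi <> 0).
  { apply Cmult_neq_0; [|apply Cexp_neq_0]; intros E; now apply RtoC_inj in E. }
  pose (kappa := (- (Ci * RtoC (beta * b)))%C).
  (* The constants are pulled out so that only exponentials with the nonzero frequencies [xi] and
     [2 * xi] have to lie in [F]. *)
  pose (fam := fun c : C => fun z =>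
    (Cexp kappa * Cexp (xi * z) + c * Cexp (2 * kappa) * Cexp ((2 * xi) * z))%C).
  assert (Hfam : forall c, F (fam c)).
  { intros c; apply (efs_plus F HF); apply (efs_scal F HF); apply Hexp; [exact Hxi|].
    apply Cmult_neq_0; [|exact Hxi]; intros E; apply RtoC_inj in E; lra. }
  assert (Efam : forall c z, fam c z =
    (Cexp (xi * z + kappa) + c * (Cexp (xi * z + kappa) * Cexp (xi * z + kappa)))%C).
  { intros c z; unfold fam; rewrite <- Cmult_assoc, <- !Cexp_plus.
    replace (kappa + xi * z)%C with (xi * z + kappa)%C by ring.
    now replace (2 * kappa + 2 * xi * z)%C
      with (xi * z + kappa + (xi * z + kappa))%C by ring. }
  destruct (Huniq (fam Ci) (fam (- Ci)%C) (Hfam _) (Hfam _)) as (tau & Htau1 & Htau).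
  - intros z (x & l & Hl & ->); destruct (HL l Hl) as [n ->].
    rewrite !Efam.
    replace (xi * (Cexp (Ci * theta) * (x + Ci * RtoC (a * IZR n + b))) + kappa)%C
      with ((beta * x, IZR n * PI) : C).
    + unfold Cexp; simpl.
      rewrite (sin_eq_0_1 (IZR n * PI)) by (now exists n).
      rewrite <- Cmod_conj; f_equal; apply injective_projections; simpl; ring.
    + unfold xi, kappa.
      replace (beta * Cexp (- (Ci * theta)) *
          (Cexp (Ci * theta) * (x + Ci * RtoC (a * IZR n + b))) + - (Ci * RtoC (beta * b)))%C
        with ((Cexp (Ci * theta) * Cexp (- (Ci * theta))) *
          (beta * (x + Ci * RtoC (a * IZR n + b))) - Ci * RtoC (beta * b))%C by ring.
      rewrite Cexp_opp_r.
      unfold beta; apply injective_projections; simpl; field; exact Ha.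
  (* At this point [E = Ci], hence [E + i E^2 = 0] while [E - i E^2 = 2 i]. *)
  - specialize (Htau ((Ci * RtoC (PI / 2) - kappa) / xi)%C).
    rewrite !Efam in Htau.
    replace (xi * ((Ci * RtoC (PI / 2) - kappa) / xi) + kappa)%C with ((0, PI / 2) : C) in Htau
      by (replace ((0, PI / 2) : C) with (Ci * RtoC (PI / 2))%C
            by (apply injective_projections; simpl; ring);
          field; exact Hxi).
    assert (EI : Cexp (0, PI / 2) = Ci).
    { unfold Cexp; simpl; rewrite exp_0, cos_PI2, sin_PI2.
      apply injective_projections; simpl; ring. }
    rewrite EI in Htau.
    replace (Ci + Ci * (Ci * Ci))%C with (RtoC 0) in Htau
      by (apply injective_projections; simpl; ring).
    replace (Ci + - Ci * (Ci * Ci))%C with (2 * Ci)%C in Htau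
      by (apply injective_projections; simpl; ring).
    assert (E := f_equal Cmod Htau).
    rewrite !Cmod_mult, Cmod_0, Htau1, Cmod_Ci, Cmod_R, Rabs_pos_eq in E; lra.
Qed.

Theorem theorem1p1 (F : (C -> C) -> Prop)
  (hF : entire_function_space F)
  (hexp : forall xi : C, xi <> RtoC 0 -> F (fun z : C => Cexp (xi * z)%C))
  (theta : R) (Lambda : R -> Prop) :
  phase_uniqueness_set (rotated_lines theta Lambda) F <->
  ~ (exists a b : R,
       forall lambda : R, Lambda lambda -> arithmetic_progression a b lambda).
Proof.
  split.
  - intros Huniq (a & b & HL).
    destruct (Req_dec a 0) as [Ha|Ha].
    (* For [a = 0] the single point [b] also lies in the progression of step 1 through [b]. *)
    + apply (not_uniqueness_of_progression F theta 1 b Lambda hF hexp); [lra| |exact Huniq].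
      intros l Hl; destruct (HL l Hl) as [n ->]; exists 0%Z; rewrite Ha; ring.
    + now apply (not_uniqueness_of_progression F theta a b Lambda hF hexp).
  - apply uniqueness_of_no_progression; apply (efs_entire F hF).
Qed.
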